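(* It holds that $\pi_{\mathcal{T}}(\mathrm{SO}(n))=\pi_{\mathcal{T}}(\mathrm{O}(n))=\pi_{\mathcal{T}}(\mathbb{B}_{\mathrm{op}}(n))$. In particular, all three sets are convex.
   Context: $\mathrm{O}(n)=\{X\in\mathbb{R}^{n\times n}:X^\intercal X=I\}$; $\mathrm{SO}(n)=\{X\in\mathrm{O}(n):\det(X)=1\}$; $\mathbb{B}_{\mathrm{op}}(n)=\{X\in\mathbb{R}^{n\times n}:\|X\|_{\mathrm{op}}\le1\}$ is the operator norm (maximum singular value) ball. The map $\pi_{\mathcal{T}}:\mathbb{R}^{n\times n}\to\mathbb{R}^{\binom n2}$, $\pi_{\mathcal{T}}(X)=(X_{ij})_{i<j}$, is the projection onto the strictly upper triangular entries. *)

(* Defs.v *)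
(* The real numbers are an arbitrary [R : realType]. *)
From mathcomp Require Import all_boot all_order all_algebra.
From mathcomp Require Import all_classical all_reals.
From mathcomp Require Import convex.

Set Implicit Arguments.
Unset Strict Implicit.
Unset Printing Implicit Defensive.

Import Order.TTheory GRing.Theory Num.Theory.

Local Open Scope classical_set_scope.
Local Open Scope ring_scope.

Definition orthogonal_group (R : realType) (n : nat) : set 'M[R]_n :=
  [set X | X^T *m X = 1%:M].

Definition special_orthogonal_group (R : realType) (n : nat) : set 'M[R]_n :=
  [set X | orthogonal_group X /\ \det X = 1].

(* The library's norm on matrices is the entrywise maximum, hence these
   separate Euclidean and operator norms. *)
Definition l2norm (R : realType) (n : nat) (v : 'cV[R]_n) : R :=
  Num.sqrt (\sum_(i < n) v i 0 ^+ 2).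

(* Vectors of norm at most 1 (rather than exactly 1) keep the set nonempty
   when n = 0. *)
Definition opnorm (R : realType) (n : nat) (X : 'M[R]_n) : R :=
  sup [set l2norm (X *m v) | v in [set v : 'cV[R]_n | l2norm v <= 1]].

(* The supremum above is a genuine one: [sup] takes a default value on sets
   that are empty or unbounded. *)
Lemma opnorm_has_sup (R : realType) (n : nat) (X : 'M[R]_n) :
  has_sup [set l2norm (X *m v) | v in [set v : 'cV[R]_n | l2norm v <= 1]].
Proof.
split.
  exists (l2norm (X *m 0)), 0 => //=.
  by rewrite /l2norm big1 ?sqrtr0// => i _; rewrite mxE expr0n.
exists (Num.sqrt (\sum_(i < n) (\sum_(j < n) `|X i j|) ^+ 2)) => _ [v /= v1 <-].
have vj1 j : `|v j 0| <= 1.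
  rewrite -sqrtr_sqr; apply: le_trans v1; rewrite ler_wsqrtr//.
  rewrite (bigD1 j)//= lerDl; apply: sumr_ge0 => i _; exact: sqr_ge0.
rewrite /l2norm ler_wsqrtr//; apply: ler_sum => i _.
rewrite -[leLHS]real_normK ?num_real// lerXn2r ?nnegrE ?sumr_ge0// mxE.
apply: le_trans (ler_norm_sum _ _ _) _; apply: ler_sum => j _.
by rewrite normrM ler_piMr.
Qed.

Definition op_ball (R : realType) (n : nat) : set 'M[R]_n :=
  [set X | opnorm X <= 1].

Definition upper_pairs (n : nat) : {set 'I_n * 'I_n} :=
  [set p : 'I_n * 'I_n | (p.1 < p.2)%N].

Lemma card_upper_pairs (n : nat) : #|upper_pairs n| = 'C(n, 2).
Proof.
rewrite -sum1_card -bin2_sum big_mkord.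
under eq_bigl do rewrite inE.
rewrite -(pair_big_dep xpredT (fun i j : 'I_n => i < j)%N (fun _ _ => 1%N))/=.
rewrite (exchange_big_dep xpredT)//=; apply: eq_bigr => j _.
by rewrite (big_ord_narrow (ltnW (ltn_ord j))) sum_nat_const card_ord muln1.
Qed.

(* Coordinates of R^(n choose 2) are identified with the pairs i < j through
   the library's canonical enumeration of this finite set. *)
Definition upper_pair (n : nat) (k : 'I_('C(n, 2))) : 'I_n * 'I_n :=
  enum_val (cast_ord (esym (card_upper_pairs n)) k).

Definition piT (R : realType) (n : nat) (X : 'M[R]_n) : 'rV[R]_('C(n, 2)) :=
  \row_(k < 'C(n, 2)) X (upper_pair k).1 (upper_pair k).2.

(* Main.v *)
(* A contraction is turned into an orthogonal matrix by normalizing its columns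
   from the last one to the first, changing only entries on or below the
   diagonal.  When columns k+1, ..., n of the contraction Z are unit vectors,
   they are orthogonal to each other and to the remaining columns.  Counting
   dimensions, there is a unit row d, supported on the coordinates k, ..., n,
   with d Z_j = 0 for all j > k.  Let A = (I - d^T d) Z and M = I - A^T A, and
   replace Z by A + d^T g, where g = M_k / sqrt M_kk is a multiple of the k-th
   row of M.  Since d A = 0, the defect I - Y^T Y of the new matrix Y is
   M - g^T g, which is positive semidefinite by Cauchy-Schwarz and vanishes at
   (k, k).  The determinant is corrected by negating the first column, which has
   no entry above the diagonal. *)
Require Import Defs.
From mathcomp Require Import all_boot all_order all_algebra.
From mathcomp Require Import all_classical all_reals.
From mathcomp Require Import convex.
From mathcomp Require Import interval_inference ring.

Set Implicit Arguments.
Unset Strict Implicit.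
Unset Printing Implicit Defensive.

Import Order.TTheory GRing.Theory Num.Theory.

Local Open Scope classical_set_scope.
Local Open Scope ring_scope.

(** * Positive semidefinite forms and Gram defects *)

Definition bilin (R : realType) (n : nat) (M : 'M[R]_n) (u v : 'cV[R]_n) : R :=
  (u^T *m M *m v) 0 0.

Definition psd (R : realType) (n : nat) (M : 'M[R]_n) :=
  forall v, 0 <= bilin M v v.

Definition sqnorm (R : realType) (n : nat) (v : 'cV[R]_n) : R :=
  \sum_(i < n) v i 0 ^+ 2.

(** Phrased through the defect [1%:M - X^T *m X] because its [j]-th diagonal entry is one minus the
    squared norm of column [j], so unit columns show up as zeros on its diagonal. *)
Definition contraction (R : realType) (n : nat) (X : 'M[R]_n) :=
  psd (1%:M - X^T *m X).

Section PositiveForms.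
Variables (R : realType) (n : nat).
Implicit Types (M X Y Z : 'M[R]_n) (u v w : 'cV[R]_n) (g : 'rV[R]_n).

Lemma bilinDl M u1 u2 v : bilin M (u1 + u2) v = bilin M u1 v + bilin M u2 v.
Proof. by rewrite /bilin linearD /= !mulmxDl mxE. Qed.

Lemma bilinDr M u v1 v2 : bilin M u (v1 + v2) = bilin M u v1 + bilin M u v2.
Proof. by rewrite /bilin mulmxDr mxE. Qed.

Lemma bilinZl M a u v : bilin M (a *: u) v = a * bilin M u v.
Proof. by rewrite /bilin linearZ /= -!scalemxAl mxE. Qed.

Lemma bilinZr M a u v : bilin M u (a *: v) = a * bilin M u v.
Proof. by rewrite /bilin -scalemxAr mxE. Qed.

Lemma bilinC M u v : M^T = M -> bilin M u v = bilin M v u.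
Proof.
move=> Ms; rewrite /bilin -[in LHS]mulmxA -[u^T *m _]trmxK [LHS]mxE.
by rewrite !trmx_mul trmxK Ms.
Qed.

Lemma bilin_delta M i j : bilin M (delta_mx i 0) (delta_mx j 0) = M i j.
Proof. by rewrite /bilin trmx_delta -rowE -colE !mxE. Qed.

Lemma bilin_delta_l M i v : bilin M (delta_mx i 0) v = (row i M *m v) 0 0.
Proof. by rewrite /bilin trmx_delta -rowE. Qed.

Lemma bilin_rank1 g v : bilin (g^T *m g) v v = (g *m v) 0 0 ^+ 2.
Proof.
rewrite /bilin mulmxA -mulmxA -trmx_mul mxE big_ord1 expr2.
by congr (_ * _); rewrite mxE.
Qed.

Lemma bilinB M1 M2 u v : bilin (M1 - M2) u v = bilin M1 u v - bilin M2 u v.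
Proof. by rewrite /bilin mulmxBr mulmxBl !mxE. Qed.

Lemma bilinD M1 M2 u v : bilin (M1 + M2) u v = bilin M1 u v + bilin M2 u v.
Proof. by rewrite /bilin mulmxDr mulmxDl !mxE. Qed.

Lemma psd_cauchy_schwarz M u v : M^T = M -> psd M ->
  bilin M u v ^+ 2 <= bilin M u u * bilin M v v.
Proof.
move=> Ms Mp.
have q a b : 0 <= a ^+ 2 * bilin M u u + a * b * bilin M u v *+ 2
                  + b ^+ 2 * bilin M v v.
  have := Mp (a *: u + b *: v).
  rewrite !(bilinDl, bilinDr, bilinZl, bilinZr) (bilinC v u) //.
  rewrite (_ : _ + b * _ = a ^+ 2 * bilin M u u + a * b * bilin M u v *+ 2
                           + b ^+ 2 * bilin M v v) //; ring.
have qu := Mp u; have qv := Mp v.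
move: (bilin M u u) (bilin M v v) (bilin M u v) q qu qv => U V B q qu qv.
have [V0|V0] := eqVneq V 0; last first.
  have V0' : 0 < V by rewrite lt_neqAle eq_sym V0.
  (* At [a = V], [b = - B] the quadratic form equals [V * (U * V - B ^+ 2)]. *)
  rewrite -subr_ge0 -(pmulr_rge0 _ V0'); have := q V (- B).
  rewrite (_ : _ + _ * V = V * (U * V - B ^+ 2)) //; ring.
have [->|B0] := eqVneq B 0; first by rewrite expr0n /= mulr_ge0.
(* With [V = 0] the form at [a = 1] is affine in [b], with slope [B *+ 2]; this [b] makes its value
   [- 1], a contradiction. *)
have := q 1 (- (U + 1) / (B *+ 2)).
suff -> : 1 ^+ 2 * U + 1 * (- (U + 1) / (B *+ 2)) * B *+ 2
   + (- (U + 1) / (B *+ 2)) ^+ 2 * V = - 1 by rewrite ler0N1.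
by rewrite V0; field; rewrite B0.
Qed.

Lemma psd_diag0 M i j : M^T = M -> psd M -> M j j = 0 -> M i j = 0.
Proof.
move=> Ms Mp Mj0; apply/eqP; rewrite -sqrf_eq0 eq_le sqr_ge0 andbT.
have := psd_cauchy_schwarz (delta_mx i 0) (delta_mx j 0) Ms Mp.
by rewrite !bilin_delta Mj0 mulr0.
Qed.

Lemma psd_diag_ge0 M i : psd M -> 0 <= M i i.
Proof. by move=> /(_ (delta_mx i 0)); rewrite bilin_delta. Qed.

Lemma gram_defect_sym X : (1%:M - X^T *m X)^T = 1%:M - X^T *m X.
Proof. by rewrite linearB /= trmx_mul trmxK trmx1. Qed.

Lemma bilin1 v : bilin 1%:M v v = sqnorm v.
Proof.
rewrite /bilin mulmx1 mxE /sqnorm.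
by apply: eq_bigr => i _; rewrite mxE expr2.
Qed.

Lemma bilin_gram X v : bilin (X^T *m X) v v = sqnorm (X *m v).
Proof. by rewrite -bilin1 /bilin mulmx1 trmx_mul !mulmxA. Qed.

Lemma contractionP X :
  contraction X <-> forall v, sqnorm (X *m v) <= sqnorm v.
Proof.
by split=> h v; move: (h v); rewrite bilinB bilin1 bilin_gram subr_ge0.
Qed.

(** By Cauchy-Schwarz a zero on the diagonal of a semidefinite matrix kills its whole column, so the
    defect vanishes. *)
Lemma contraction_unit_columns X : contraction X ->
  (forall j, (1%:M - X^T *m X) j j = 0) -> orthogonal_group X.
Proof.
move=> Xc Xd; apply/esym/eqP; rewrite -subr_eq0; apply/eqP/matrixP => i j.
by rewrite (psd_diag0 _ (gram_defect_sym X) Xc (Xd j)) [in RHS]mxE.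
Qed.

(** * Completing a contraction to an orthogonal matrix *)

Lemma exists_unit_row Z (k : 'I_n) :
  exists d : 'rV[R]_n, [/\ d *m d^T = 1%:M, forall i : 'I_n, (i < k)%N -> d 0 i = 0
    & forall j : 'I_n, (k < j)%N -> (d *m Z) 0 j = 0].
Proof.
(* A row [d] with [d *m N = 0] meets all the linear conditions at once: columns before [k] force
   [d 0 j = 0], columns after [k] force [(d *m Z) 0 j = 0]. The zero column [k] makes [N]
   singular. *)
pose N := \matrix_(i, j) if (j < k)%N then (i == j)%:R
                         else if (k < j)%N then Z i j else 0 : R.
have /eqP/det0P[d d0 dN] : \det N = 0.
  rewrite (expand_det_col _ k) big1 // => i _.
  by rewrite mxE ltnn mul0r.
have c0 : 0 < sqnorm d^T.
  rewrite lt_neqAle eq_sym /sqnorm psumr_neq0 => [|i _]; last exact: sqr_ge0.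
  rewrite sumr_ge0 ?andbT => [|i _]; last exact: sqr_ge0.
  case/rV0Pn: d0 => i di; apply/hasP; exists i; first exact: mem_index_enum.
  by rewrite mxE lt_neqAle sqr_ge0 eq_sym sqrf_eq0 di.
have dNj j : \sum_i d 0 i * N i j = 0.
  by have := congr1 (fun A : 'rV[R]_n => A 0 j) dN; rewrite !mxE.
exists ((Num.sqrt (sqnorm d^T))^-1 *: d); split=> [|i ik|j kj].
- rewrite linearZ /= -scalemxAl -scalemxAr scalerA -invfM -expr2.
  rewrite sqr_sqrtr ?ltW //; apply/matrixP => i j; rewrite !ord1 !mxE eqxx.
  rewrite [X in _ * X](_ : _ = sqnorm d^T) ?mulVf ?gt_eqF //.
  by apply: eq_bigr => l _; rewrite mxE expr2.
- rewrite mxE (_ : d 0 i = 0) ?mulr0 //.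
  have := dNj i; rewrite (bigD1 i) //= big1 => [|l /negPf li].
    by rewrite mxE ik eqxx mulr1 addr0.
  by rewrite mxE ik li mulr0.
- rewrite -scalemxAl !mxE (_ : \sum_l _ = 0) ?mulr0 // -[RHS](dNj j).
  by apply: eq_bigr => l _; rewrite mxE kj ltnNge ltnW.
Qed.

Lemma contraction_unit_column_step Z (k : 'I_n) : contraction Z ->
  (forall j : 'I_n, (k < j)%N -> (1%:M - Z^T *m Z) j j = 0) ->
  exists Y, [/\ contraction Y,
    forall j : 'I_n, (k <= j)%N -> (1%:M - Y^T *m Y) j j = 0
    & forall i j : 'I_n, (i < j)%N -> Y i j = Z i j].
Proof.
move=> Zc Zd; have [d [d1 dlow dZ]] := exists_unit_row Z k.
pose A := Z - d^T *m (d *m Z).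
pose M := 1%:M - A^T *m A.
have dA : d *m A = 0 by rewrite mulmxBr [d *m (_ *m _)]mulmxA d1 mul1mx subrr.
have Ms : M^T = M := gram_defect_sym A.
(* Removing the component of [Z] along [d] enlarges the defect by a rank-one square, which vanishes
   on the diagonal beyond [k]. *)
have ME : M = (1%:M - Z^T *m Z) + (d *m Z)^T *m (d *m Z).
  rewrite /M; have -> : A^T *m A = A^T *m Z.
    rewrite [in X in _ *m X]/A mulmxBr [A^T *m (_ *m _)]mulmxA.
    by rewrite -trmx_mul dA trmx0 mul0mx subr0.
  rewrite /A linearB /= trmx_mul trmxK.
  by rewrite mulmxBl opprB addrA mulmxA [in RHS]addrAC.
have Mp : psd M.
  by move=> v; rewrite ME bilinD bilin_rank1 addr_ge0 // sqr_ge0.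
have Md (j : 'I_n) : (k < j)%N -> M j j = 0.
  move=> kj; rewrite ME mxE Zd // add0r mxE big_ord1 mxE dZ //.
  by rewrite mul0r.
(* If [M k k = 0], the inverse is 0 and so is [g]. *)
pose g := (Num.sqrt (M k k))^-1 *: row k M.
pose Y := A + d^T *m g.
have YM : 1%:M - Y^T *m Y = M - g^T *m g.
  have Ad : A^T *m d^T = 0 by rewrite -trmx_mul dA trmx0.
  rewrite /Y /M [(A + _)^T]linearD /= trmx_mul trmxK mulmxDr !mulmxDl.
  rewrite -[g^T *m d *m A]mulmxA dA mulmx0 addr0.
  rewrite [A^T *m (_ *m _)]mulmxA Ad mul0mx add0r.
  by rewrite -[g^T *m d *m _]mulmxA [d *m _]mulmxA d1 mul1mx opprD addrA.
have Mkk := psd_diag_ge0 k Mp.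
have Yc : contraction Y.
  move=> v; rewrite YM bilinB bilin_rank1 subr_ge0.
  rewrite -scalemxAl mxE -bilin_delta_l exprMn exprVn sqr_sqrtr //.
  have [->|k0] := eqVneq (M k k) 0; first by rewrite invr0 mul0r Mp.
  rewrite ler_pdivrMl ?lt_neqAle 1?eq_sym ?k0 //.
  by rewrite -(bilin_delta M k k) psd_cauchy_schwarz.
have Yjj j : (1%:M - Y^T *m Y) j j = M j j - g 0 j ^+ 2.
  by rewrite YM !mxE big_ord1 !mxE expr2.
(* Beyond [k] the new diagonal defect is [- g 0 j ^+ 2], yet it is nonnegative. *)
have g0 (j : 'I_n) : (k < j)%N -> g 0 j = 0.
  move=> kj; have := psd_diag_ge0 j Yc; rewrite Yjj Md // sub0r oppr_ge0.
  by move=> g2; apply/eqP; rewrite -sqrf_eq0 eq_le g2 sqr_ge0.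
exists Y; split=> // [j|i j ij].
  rewrite leq_eqVlt => /orP[/eqP/val_inj <-|kj]; rewrite Yjj; last first.
    by rewrite g0 // Md // expr0n subrr.
  rewrite [g 0 k]mxE [row k M _ _]mxE exprMn exprVn sqr_sqrtr //.
  have [->|k0] := eqVneq (M k k) 0; first by rewrite expr0n mulr0 subrr.
  by rewrite expr2 mulrA mulVf // mul1r subrr.
(* The change is the product of [d^T] and [g - d *m Z]: for [i < k] the first factor vanishes at
   [i], and for [k <= i < j] the second vanishes at [j]. *)
have -> : Y = Z + d^T *m (g - d *m Z) by rewrite /Y /A mulmxBr addrAC addrA.
rewrite [LHS]mxE [X in _ + X](_ : _ = 0) ?addr0 // mxE big_ord1.
have [ik|ki] := ltnP i k; first by rewrite [d^T _ _]mxE dlow ?mul0r.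
have kj := leq_ltn_trans ki ij.
by rewrite [X in _ * X]mxE g0 // [X in 0 + X]mxE dZ // subrr mulr0.
Qed.

Lemma contraction_orthogonal_completion Z : contraction Z ->
  exists2 Y, orthogonal_group Y & forall i j : 'I_n, (i < j)%N -> Y i j = Z i j.
Proof.
move=> Zc.
(* Induction on the number [m] of trailing unit columns; for [m = 0] the condition is vacuous. *)
suff H m : (m <= n)%N -> exists Y, [/\ contraction Y,
    forall j : 'I_n, (n - m <= j)%N -> (1%:M - Y^T *m Y) j j = 0
    & forall i j : 'I_n, (i < j)%N -> Y i j = Z i j].
  have [Y [Yc Yd YZ]] := H n (leqnn n); exists Y => //.
  by apply: contraction_unit_columns => // j; apply: Yd; rewrite subnn.
elim: m => [_|m IHm mn].
  exists Z; split=> // j; by rewrite subn0 leqNgt ltn_ord.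
have [Y [Yc Yd YZ]] := IHm (ltnW mn).
have kn : (n - m.+1 < n)%N by rewrite ltn_subrL (leq_trans _ mn).
have [|W [Wc Wd WY]] := @contraction_unit_column_step Y (Ordinal kn) Yc.
  by move=> j /=; rewrite subnSK // => /Yd.
exists W; split=> // i j ij; by rewrite WY ?YZ.
Qed.

(** * Contractions as the operator norm ball; orthogonality and convexity *)

Lemma l2normE v : l2norm v = Num.sqrt (sqnorm v).
Proof. by []. Qed.

Lemma sqnorm_ge0 v : 0 <= sqnorm v.
Proof. by apply: sumr_ge0 => i _; apply: sqr_ge0. Qed.

Lemma sqnormZ a v : sqnorm (a *: v) = a ^+ 2 * sqnorm v.
Proof. by rewrite -!bilin1 bilinZl bilinZr mulrA expr2. Qed.

(** By homogeneity, a bound on the unit ball extends to every nonzero vector after normalization. *)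
Lemma op_ball_contraction X : op_ball X <-> contraction X.
Proof.
rewrite contractionP; split=> [Xb v|Xc]; last first.
  apply: ge_sup; first by case: (opnorm_has_sup X).
  move=> _ [v /= v1 <-]; apply: le_trans v1.
  by rewrite !l2normE ler_wsqrtr.
have Xs u : sqnorm u <= 1 -> sqnorm (X *m u) <= 1.
  move=> u1; rewrite -[leLHS]sqr_sqrtr ?sqnorm_ge0 // expr_le1 ?sqrtr_ge0 //.
  apply: le_trans Xb; apply: ub_le_sup; first by case: (opnorm_has_sup X).
  by exists u; rewrite //= l2normE -sqrtr1 ler_wsqrtr.
have [v0|v0] := eqVneq (sqnorm v) 0.
  suff -> : v = 0 by rewrite mulmx0.
  apply/colP => i; rewrite mxE; apply/eqP; rewrite -sqrf_eq0.
  move/eqP: v0; rewrite psumr_eq0 => [/allP|j _]; last exact: sqr_ge0.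
  by move/(_ i (mem_index_enum _)).
have {}v0 : 0 < sqnorm v by rewrite lt_neqAle eq_sym v0 sqnorm_ge0.
have := Xs ((Num.sqrt (sqnorm v))^-1 *: v).
rewrite -scalemxAr !sqnormZ exprVn sqr_sqrtr ?sqnorm_ge0 //.
by rewrite mulVf ?gt_eqF // !ler_pdivrMl // mulr1; apply.
Qed.

Lemma orthogonal_contraction X : orthogonal_group X -> contraction X.
Proof. by move=> XX v; rewrite XX subrr /bilin mulmx0 mul0mx mxE. Qed.

Lemma orthogonal_det X : orthogonal_group X -> \det X = 1 \/ \det X = - 1.
Proof.
move=> /(congr1 (fun A => \det A)); rewrite det_mulmx det_tr det1 -expr2.
by move/eqP; rewrite sqrf_eq1 => /orP[] /eqP; [left|right].
Qed.

Lemma contraction_convex X Y t : 0 <= t <= 1 ->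
  contraction X -> contraction Y -> contraction (t *: X + (1 - t) *: Y).
Proof.
move=> /andP[t0 t1] /contractionP Xc /contractionP Yc; apply/contractionP => v.
have -> : sqnorm v = t * sqnorm v + (1 - t) * sqnorm v by ring.
apply: (@le_trans _ _ (t * sqnorm (X *m v) + (1 - t) * sqnorm (Y *m v))).
  rewrite !mulr_sumr -big_split /=; apply: ler_sum => i _.
  rewrite mulmxDl -!scalemxAl !mxE.
  set x := \sum_j (X i j * _); set y := \sum_j (Y i j * _); rewrite -subr_ge0.
  (* The convexity gap of the square function, taken coordinate by coordinate. *)
  rewrite (_ : _ - _ = t * (1 - t) * (x - y) ^+ 2); last by ring.
  by apply: mulr_ge0 (sqr_ge0 _); rewrite mulr_ge0 // subr_ge0.
by rewrite lerD // ler_wpM2l // subr_ge0.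
Qed.

End PositiveForms.

(** * Determinant correction and the projected sets *)

Lemma orthogonal_special (R : realType) (n : nat) (X : 'M[R]_n) :
  orthogonal_group X ->
  exists2 Y, special_orthogonal_group Y
    & forall i j : 'I_n, (i < j)%N -> Y i j = X i j.
Proof.
case: n X => [|n] X XX; first by exists X => //; split; rewrite // det_mx00.
have [X1|X1] := orthogonal_det XX; first by exists X.
(* Right multiplication by [D] negates column 0 only, and [i < j] excludes [j = 0]. *)
pose D : 'M[R]_n.+1 := diag_mx (\row_j if j == 0 then - 1 else 1).
have D2 : D *m D = 1%:M.
  rewrite mulmx_diag -diag_const_mx; congr diag_mx; apply/rowP => j.
  by rewrite !mxE; case: ifP; rewrite ?mulrNN mulr1.
exists (X *m D) => [|i j ij]; last first.
  rewrite mul_mx_diag !mxE ifF ?mulr1 //.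
  by apply/negP => /eqP j0; rewrite j0 in ij.
split.
  rewrite /orthogonal_group /= trmx_mul tr_diag_mx mulmxA.
  by rewrite -[_ *m X]mulmxA XX mulmx1.
rewrite det_mulmx X1 det_diag (bigD1 ord0) //= mxE eqxx.
rewrite big1 ?mulr1 ?mulrNN ?mulr1 // => j /negPf j0.
by rewrite mxE j0.
Qed.

Lemma piT_eq (R : realType) (n : nat) (X Y : 'M[R]_n) :
  (forall i j : 'I_n, (i < j)%N -> X i j = Y i j) -> piT X = piT Y.
Proof.
move=> XY; apply/rowP => k; rewrite !mxE; apply: XY.
by have := enum_valP (cast_ord (esym (card_upper_pairs n)) k); rewrite inE.
Qed.

Theorem corollary2 (R : realType) (n : nat) :
  ((@piT R n @` @special_orthogonal_group R n = @piT R n @` @orthogonal_group R n)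
   /\ (@piT R n @` @orthogonal_group R n = @piT R n @` @op_ball R n))
  /\ [/\ convex_set (@piT R n @` @special_orthogonal_group R n),
         convex_set (@piT R n @` @orthogonal_group R n)
       & convex_set (@piT R n @` @op_ball R n)].
Proof.
have SO : @piT R n @` @special_orthogonal_group R n
        = @piT R n @` @orthogonal_group R n.
  apply/seteqP; split=> [_ [X [XO _] <-]|_ [X XO <-]]; first by exists X.
  have [Y Ys YX] := orthogonal_special XO.
  by exists Y => //; apply: piT_eq.
have OB : @piT R n @` @orthogonal_group R n = @piT R n @` @op_ball R n.
  apply/seteqP; split=> [_ [X XO <-]|_ [X /op_ball_contraction Xc <-]].
    by exists X => //; apply/op_ball_contraction/orthogonal_contraction.
  have [Y YO YX] := contraction_orthogonal_completion Xc.
  by exists Y => //; apply: piT_eq.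
(* Convexity is checked on the ball, where it comes from convexity of contractions and linearity of
   [piT]; the set equalities transfer it to the other two. *)
have cB : convex_set (@piT R n @` @op_ball R n).
  move=> x y t; rewrite !inE => -[X /op_ball_contraction Xc <-].
  move=> [Y /op_ball_contraction Yc <-].
  exists (t%:num *: X + (1 - t%:num) *: Y).
    by apply/op_ball_contraction/contraction_convex => //; rewrite ge0 le1.
  by apply/rowP => k; rewrite !mxE.
by rewrite SO OB.
Qed.
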